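(* Every interacting Fock 2-space $\mathcal I_2^0=\Omega\mathbb C\oplus H_1\oplus\Omega_2\mathbb C$ for which $H_1$ has a countable Hamel basis is regular (though, not necessarily iso-regular).
   Context: All vector spaces are complex; direct sums and tensor products of pre-Hilbert spaces are algebraic; $\overline V$ is the completion of a pre-Hilbert space $V$; $\mathscr L(V,W)$ is the space of all linear maps $V\to W$, $\mathscr L(V)=\mathscr L(V,V)$. An interacting Fock space $((H_n)_{n\in\mathbb N_0},A^* )$ consists of pre-Hilbert spaces $H_n$ with $H_0=\Omega\mathbb C$ ($\Omega$ a unit vector), $\mathcal I=\bigoplus_nH_n$, and a linear subspace $A^*\subset\mathscr L(\mathcal I)$ with $\operatorname{span}A^*H_n=H_{n+1}$ for all $n$. An interacting Fock 2-space is $\mathcal I_2^0=\Omega\mathbb C\oplus H_1\oplus\Omega_2\mathbb C$ with $H_1$ a pre-Hilbert space, $\Omega,\Omega_2$ unit vectors (so $H_2=\Omega_2\mathbb C$, $H_n=\{0\}$ for $n\ge3$), together with $A^*=\{a^*(x):x\in H_1\}$, where $a^*(x)\Omega=x$, $a^*(x)y=\Omega_2\Phi(x\otimes y)$ for $y\in H_1$, and $a^*(x)\Omega_2=0$, for a nonzero linear functional $\Phi\colon H_1\otimes H_1\to\mathbb C$. The map $x\mapsto a^*(x)$ is its iso-basing (on the pre-Hilbert space $H_1$). For a pre-Hilbert space $H$, $\mathscr F(H)=\Omega\mathbb C\oplus\bigoplus_{n\ge1}H^{\otimes n}$ is the algebraic full Fock space with natural inner product. A basing of an interacting Fock space on $H$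 is a surjective linear map $b\colon H\to A^*$. The associated map $\Lambda\colon\mathscr F(H)\to\mathcal I$ is linear with $\Lambda\Omega=\Omega$, $\Lambda(x_n\otimes\dots\otimes x_1)=b(x_n)\cdots b(x_1)\Omega$. The basing is regular if there is $\Lambda^*\in\mathscr L(\mathcal I,\overline{\mathscr F(H)})$ with $\langle\Lambda X,Y\rangle=\langle X,\Lambda^*Y\rangle$ for all $X\in\mathscr F(H)$, $Y\in\mathcal I$. An interacting Fock space is regular if it admits a regular basing on some pre-Hilbert space $H$; an interacting Fock 2-space is iso-regular if its iso-basing on $H_1$ is regular. *)

(* Defs.v *)
From HB Require Import structures.
From mathcomp Require Import all_boot all_order all_algebra.
From mathcomp Require Import sesquilinear complex.
From mathcomp Require Import boolp classical_sets functions cardinality reals.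

Set Implicit Arguments.
Unset Strict Implicit.
Unset Printing Implicit Defensive.

Import Order.TTheory GRing.Theory Num.Theory.
Local Open Scope ring_scope.
Local Open Scope classical_set_scope.

(* Pre-Hilbert spaces. Inner products are linear in the first argument and
   conjugate-linear in the second one; no notion below depends on this choice. *)

Record preHilbert (R : realType) := PreHilbert {
  ph_sort :> lmodType R[i];
  ph_inner : {dot ph_sort for Num.conj}
}.

Definition inner (R : realType) (V : preHilbert R) (x y : V) : R[i] :=
  ph_inner V x y.

Definition hnorm (R : realType) (V : preHilbert R) (x : V) : R :=
  Num.sqrt (complex.Re (inner x x)).

Section LinearAlgebra.
Context (K : fieldType) (V : lmodType K).

Definition subspace (A : set V) : Prop :=
  A 0 /\ forall (a : K) (x y : V), A x -> A y -> A (a *: x + y).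

Definition span (A : set V) : set V :=
  [set v | exists (s : seq V) (c : V -> K),
     (forall x, x \in s -> A x) /\ v = \sum_(x <- s) c x *: x].

Definition lin_indep (A : set V) : Prop :=
  forall (s : seq V) (c : V -> K), uniq s -> (forall x, x \in s -> A x) ->
    \sum_(x <- s) c x *: x = 0 -> forall x, x \in s -> c x = 0.

Definition hamel_basis (A : set V) : Prop := lin_indep A /\ span A = setT.

End LinearAlgebra.

(* Finite Hamel bases count as countable ones. *)
Definition has_countable_hamel_basis (R : realType) (V : preHilbert R) : Prop :=
  exists B : set V, countable B /\ hamel_basis B.

(* The completion of [V], specified up to unitary equivalence over [V]: a
   complete pre-Hilbert space in which [V] embeds isometrically and densely. *)
Record completion (R : realType) (V : preHilbert R) := Completion {
  cp_space :> preHilbert R;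
  cp_emb : {linear V -> cp_space};
  cp_isometric : forall x y, inner (cp_emb x) (cp_emb y) = inner x y;
  cp_dense : forall (z : cp_space) (e : R), 0 < e ->
    exists x : V, hnorm (z - cp_emb x) < e;
  cp_complete : forall u : nat -> cp_space,
    (forall e : R, 0 < e -> exists N : nat, forall m n : nat,
       (N <= m)%N -> (N <= n)%N -> hnorm (u m - u n) < e) ->
    exists l : cp_space, forall e : R, 0 < e -> exists N : nat,
      forall n : nat, (N <= n)%N -> hnorm (u n - l) < e
}.

(* [f] restricted to sequences of length n is n-linear, for every n. *)
Definition multilinear (K : fieldType) (V W : lmodType K) (f : seq V -> W) :=
  forall (s t : seq V) (a : K) (x y : V),
    f (s ++ (a *: x + y) :: t) = a *: f (s ++ x :: t) + f (s ++ y :: t).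

(* The algebraic full Fock space over [H], specified by the universal property
   of the direct sum of all the algebraic tensor powers of [H]. The vector
   [ff_tens [:: x_n; ...; x_1]] is the elementary tensor of x_n, ..., x_1, and
   [ff_tens [::]] is the vacuum. *)
Record full_fock (R : realType) (H : preHilbert R) := FullFock {
  ff_space :> preHilbert R;
  ff_tens : seq H -> ff_space;
  ff_multilinear : multilinear ff_tens;
  ff_universal : forall (W : lmodType R[i]) (f : seq H -> W), multilinear f ->
    exists2 g : {linear ff_space -> W}, (forall s, g (ff_tens s) = f s) &
      forall g' : {linear ff_space -> W},
        (forall s, g' (ff_tens s) = f s) -> g' =1 g;
  ff_inner : forall s t, inner (ff_tens s) (ff_tens t) =
    if size s == size t then \prod_(p <- zip s t) inner p.1 p.2 else 0
}.

(* Interacting Fock spaces, as internal orthogonal direct sums of the levels. *)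
Record interacting_fock (R : realType) := InteractingFock {
  if_space :> preHilbert R;
  if_level : nat -> set if_space;
  if_vac : if_space;
  if_creators : set (if_space -> if_space);
  if_level_subspace : forall n, subspace (if_level n);
  if_level_orth : forall m n x y, m <> n ->
    if_level m x -> if_level n y -> inner x y = 0;
  if_level_sum : forall x, exists (n : nat) (u : nat -> if_space),
    (forall k, if_level k (u k)) /\ x = \sum_(k < n) u k;
  if_vac_unit : inner if_vac if_vac = 1;
  if_level0 : if_level 0%N = [set c *: if_vac | c in [set: R[i]]];
  if_creators_linear : forall f, if_creators f -> linear f;
  if_creators_subspace : subspace if_creators;
  if_span : forall n,
    span [set f x | f in if_creators & x in if_level n] = if_level n.+1
}.

Section Basings.
Context (R : realType) (I : interacting_fock R) (H : preHilbert R).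

Definition basing (b : {linear H -> (I -> I)}) : Prop :=
  range b = @if_creators R I.

(* The map denoted by Lambda; [s = [::]] yields that it preserves the vacuum. *)
Definition fock_map (b : {linear H -> (I -> I)}) (F : full_fock H)
    (L : {linear F -> I}) : Prop :=
  forall s : seq H, L (ff_tens F s) = foldr (fun x v => b x v) (if_vac I) s.

Definition regular_basing (b : {linear H -> (I -> I)}) : Prop :=
  basing b /\
  exists (F : full_fock H) (K : completion F)
         (L : {linear F -> I}) (Ladj : {linear I -> K}),
    fock_map b L /\
    forall (X : F) (Y : I), inner (L X) Y = inner (cp_emb K X) (Ladj Y).

End Basings.

Definition regular (R : realType) (I : interacting_fock R) : Prop :=
  exists (H : preHilbert R) (b : {linear H -> (I -> I)}), regular_basing b.

(* The data of an interacting Fock 2-space. A linear functional on the algebraic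
   tensor square of [f2_H1] is the same thing as a bilinear form on [f2_H1]. *)
Record fock2 (R : realType) := Fock2 {
  f2_H1 : preHilbert R;
  f2_Phi : {biscalar f2_H1};
  f2_Phi_neq0 : exists x y, f2_Phi x y != 0
}.

(* ((a, x), b) stands for the sum of a times the vacuum, x, and b times the unit
   vector spanning the second level. *)
Section Fock2Space.
Context (R : realType) (H : preHilbert R).

Definition f2_carrier : lmodType R[i] := (R[i]^o * H * R[i]^o)%type.

Definition f2_form (v w : f2_carrier) : R[i] :=
  v.1.1 * (w.1.1)^* + inner v.1.2 w.1.2 + v.2 * (w.2)^*.

Lemma f2_form_bilinear : bilinear_for *%R (Num.conj \; *%R) f2_form.
Proof.
split=> [w a u v|w a u v]; rewrite /f2_form /inner /=.
- rewrite linearPl /= !mulrDl !mulrDr -!mulrA -!addrA; congr (_ + _).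
  rewrite [LHS]addrCA; congr (_ + _).
  by rewrite [LHS]addrA [LHS]addrCA -addrA.
- rewrite linearPr /= !rmorphD !rmorphM /= !mulrDr.
  rewrite ![_ * (a^* * _)]mulrCA -!addrA; congr (_ + _).
  rewrite [LHS]addrCA; congr (_ + _).
  by rewrite [LHS]addrA [LHS]addrCA -addrA.
Qed.

Lemma f2_form_hermitian (x y : f2_carrier) :
  f2_form x y = (-1) ^+ false * (f2_form y x)^*.
Proof.
rewrite expr0 mul1r /f2_form !rmorphD !rmorphM /= !conjCK /inner.
rewrite (hermC (ph_inner H) x.1.2) expr0 mul1r.
by congr (_ + _ + _); rewrite mulrC.
Qed.

Lemma f2_form_gt0 (x : f2_carrier) : x != 0 -> 0 < f2_form x x.
Proof.
case: x => -[a x] b; rewrite /f2_form /inner /= => x_neq0.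
have a0 : 0 <= a * a^* by rewrite mul_conjC_ge0.
have b0 : 0 <= b * b^* by rewrite mul_conjC_ge0.
have x0 : 0 <= ph_inner H x x by exact: dnorm_ge0.
rewrite lt_neqAle !addr_ge0// andbT eq_sym paddr_eq0 ?addr_ge0//.
rewrite paddr_eq0// !mul_conjC_eq0 dnorm_eq0.
by apply: contra x_neq0 => /andP[/andP[/eqP-> /eqP->] /eqP->].
Qed.

HB.instance Definition _ :=
  @bilinear_isBilinear.Build _ _ _ _ _ _ f2_form f2_form_bilinear.
HB.instance Definition _ :=
  @isHermitianSesquilinear.Build _ _ _ _ f2_form f2_form_hermitian.
HB.instance Definition _ := @isDotProduct.Build _ _ f2_form f2_form_gt0.

Definition f2_space : preHilbert R :=
  @PreHilbert R f2_carrier (f2_form : {dot f2_carrier for Num.conj}).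

Definition f2_vac : f2_space := (1, 0, 0).

Definition f2_level (n : nat) : set f2_space :=
  match n with
  | 0 => [set v | v.1.2 = 0 /\ v.2 = 0]
  | 1 => [set v | v.1.1 = 0 /\ v.2 = 0]
  | 2 => [set v | v.1.1 = 0 /\ v.1.2 = 0]
  | _ => [set 0]
  end.

End Fock2Space.

Section Fock2.
Context (R : realType) (I2 : fock2 R).
Local Notation H := (f2_H1 I2).
Local Notation Phi := (f2_Phi I2).

Definition f2_create (x : H) : f2_space H -> f2_space H :=
  fun v => (0, v.1.1 *: x, Phi x v.1.2).

Lemma f2_create_linearl : linear f2_create.
Proof.
move=> a x y; apply/funext => -[[c z] d].
rewrite /f2_create /= -[RHS]/(_, _, _) /=.
congr (_, _, _).
- by rewrite scaler0 addr0.
- by rewrite scalerDr !scalerA mulrC.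
- by rewrite linearPl.
Qed.

HB.instance Definition _ :=
  GRing.isLinear.Build R[i] H (f2_space H -> f2_space H) _ f2_create
    f2_create_linearl.

Lemma f2_create_linearr (x : H) : linear (f2_create x).
Proof.
move=> a [[c y] d] [[c' y'] d']; rewrite /f2_create /= -[RHS]/(_, _, _) /=.
congr (_, _, _).
- by rewrite scaler0 addr0.
- by rewrite scalerDl scalerA.
- by rewrite linearPr.
Qed.

Definition iso_basing : {linear H -> (f2_space H -> f2_space H)} := f2_create.

Local Notation I := (f2_space H).
Local Notation level := (@f2_level R H).

Lemma f2_level_subspace n : subspace (level n).
Proof.
case: n => [|[|[|n]]]; split=> //=.
- by move=> a x y [-> ->] [-> ->]; rewrite !scaler0 !addr0.
- by move=> a x y [-> ->] [-> ->]; rewrite !scaler0 !addr0.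
- by move=> a x y [-> ->] [-> ->]; rewrite !scaler0 !addr0.
- by move=> a x y -> ->; rewrite scaler0 addr0.
Qed.

Lemma f2_inner (v w : I) :
  inner v w = v.1.1 * (w.1.1)^* + inner v.1.2 w.1.2 + v.2 * (w.2)^*.
Proof. by []. Qed.

Lemma f2_level_orth m n (x y : I) : m <> n ->
  level m x -> level n y -> inner x y = 0.
Proof.
rewrite f2_inner /inner; case: x y => [[a x] b] [[c y] d] /=.
by case: m n => [|[|[|m]]] [|[|[|n]]] //= _;
  do 2![case; do ?[move->]] => *; subst;
  rewrite ?(conjC0, linear0l, linear0r, mul0r, mulr0, addr0).
Qed.

Lemma f2_level_sum (x : I) : exists (n : nat) (u : nat -> I),
  (forall k, level k (u k)) /\ x = \sum_(k < n) u k.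
Proof.
case: x => [[a x] b]; exists 3%N, (fun k => match k with
  | 0 => (a, 0, 0) | 1 => (0, x, 0) | 2 => (0, 0, b) | _ => 0 end : I).
split; first by case=> [|[|[|k]]].
rewrite !big_ord_recl big_ord0 /= addr0 -[RHS]/(_, _, _) /=.
by congr (_, _, _); rewrite ?add0r ?addr0.
Qed.

Lemma f2_vac_unit : inner (f2_vac H) (f2_vac H) = 1.
Proof.
by rewrite f2_inner /inner /= rmorph1 linear0l mulr1 mul0r !addr0.
Qed.

Lemma f2_level0 : level 0%N = [set c *: f2_vac H | c in [set: R[i]]].
Proof.
apply/seteqP; split=> [[[a x] b] /= [-> ->]|_ [c _ <-]] /=.
  exists a => //; rewrite -[LHS]/(_, _, _) /=.
  by congr (_, _, _); rewrite ?scaler0 //; apply: mulr1.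
by rewrite !scaler0.
Qed.

Definition f2_creators : set (I -> I) := range iso_basing.

Lemma f2_creators_linear f : f2_creators f -> linear f.
Proof. by case=> x _ <-; apply: f2_create_linearr. Qed.

Lemma f2_creators_subspace : subspace f2_creators.
Proof.
split; first by exists 0 => //; apply: linear0.
move=> a f g [x _ <-] [y _ <-]; exists (a *: x + y) => //.
exact: linearP.
Qed.

Lemma sub_span (A : set I) v : A v -> span A v.
Proof.
move=> Av; exists [:: v], (fun=> 1).
by split=> [x|]; rewrite ?inE ?big_seq1 ?scale1r// => /eqP->.
Qed.

Lemma subspace_span (A B : set I) : subspace B -> A `<=` B -> span A `<=` B.
Proof.
move=> [B0 BD] AB v [s [c [sA ->]]]; elim: s sA => [|x s IH] sA.
  by rewrite big_nil.
rewrite big_cons; apply: BD; first by apply/AB/sA; rewrite inE eqxx.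
by apply: IH => y ys; apply: sA; rewrite inE ys orbT.
Qed.

Lemma f2_span n :
  span [set f x | f in f2_creators & x in level n] = level n.+1.
Proof.
apply/seteqP; split.
  apply: subspace_span; first exact: f2_level_subspace.
  move=> _ [_ [x _ <-] [[[a y] b] + <-]].
  case: n => [|[|[|n]]] /=; rewrite /f2_create /=.
  - by case=> -> _; rewrite linear0r.
  - by case=> -> _; rewrite scale0r.
  - by case=> -> ->; rewrite scale0r linear0r.
  - by case=> -> -> _; rewrite scale0r linear0r.
case: n => [|[|n]] /= [[a y] b] /=.
- case=> -> ->; apply: sub_span; exists (iso_basing y); first by exists y.
  exists (f2_vac H) => //=.
  by rewrite /f2_create /= scale1r linear0r.
- case=> -> ->; have [x [z xz]] := f2_Phi_neq0 I2.
  apply: sub_span; exists (iso_basing x); first by exists x.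
  exists (0, (b / Phi x z) *: z, 0) => //=.
  by rewrite /f2_create /= scale0r linearZr_LR /= divfK.
- move=> [-> -> ->]; apply: sub_span; exists (iso_basing 0); first by exists 0.
  exists 0; first by case: n.
  by rewrite linear0.
Qed.

Definition fock2_if : interacting_fock R :=
  @InteractingFock R I level (f2_vac H) f2_creators f2_level_subspace
    f2_level_orth f2_level_sum f2_vac_unit f2_level0 f2_creators_linear
    f2_creators_subspace f2_span.

Definition iso_regular : Prop := @regular_basing R fock2_if H iso_basing.

End Fock2.

(* Main.v *)
From HB Require Import structures.
From mathcomp Require Import all_boot all_order all_algebra reals.
From mathcomp Require Import sesquilinear complex.
From mathcomp Require Import boolp classical_sets functions cardinality.
From mathcomp Require Import topology normedtype sequences.
From mathcomp Require Import ring lra.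
Require Import Defs.

(** The creators of a Fock 2-space send an elementary tensor of length n
    to the vacuum, to a vector of H_1, to a multiple of Omega_2 given by
    Phi, or to 0, according as n = 0, 1, 2 or n > 2. The adjoint of this
    map exists as soon as the images of an orthonormal basis of the full
    Fock space are square summable ([adjointP]): the adjoint of Y is then
    the square summable family of its inner products with these images.

    A basing need not live on H_1 with its own inner product, and this is
    the freedom that makes every space with a countable spanning sequence
    f_n regular. Take H with orthonormal basis e_n, and let e_n act as the
    creator of c_n f_n. Every vector of H_1 is still reached, and only
    countably many numbers, the norms of the f_n and the values Phi(f_m,
    f_n), have to be beaten by the weights c_n and c_m c_n. A diagonal
    choice of the c_n does so ([exists_weights]): c_n depends on the
    finitely many entries with both indices at most n.

    The space H is realized as the polynomials, with the monomials as
    orthonormal basis. Its full Fock space has an orthonormal basis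
    indexed by the finite words in the natural numbers, and a bijection
    between words and natural numbers makes it another copy of the
    polynomials. The completion of the polynomials is the space of square
    summable sequences, so that one space of sequences carries the whole
    construction.

    Iso-regularity fails when Phi is unbounded. On the polynomials the
    form Phi(p, q) = (p' q)(1) takes the value n on the unit vectors X^n
    and 1, while, by Cauchy-Schwarz, an adjoint would bound it on
    unit vectors. *)

Set Implicit Arguments.
Unset Strict Implicit.
Unset Printing Implicit Defensive.
Import Order.TTheory GRing.Theory Num.Theory.
Import numFieldNormedType.Exports.
Local Open Scope ring_scope.
Local Open Scope classical_set_scope.

(** * Complex sequences *)

Section ComplexSequences.
Context (R : realType).
Local Notation C := R[i].
Local Notation Re := (@complex.Re R).
Local Notation Im := (@complex.Im R).
Implicit Types (z w a : C) (u v s : nat -> C).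

Definition csq z : R := Re z ^+ 2 + Im z ^+ 2.

Lemma csq_ge0 z : 0 <= csq z.
Proof. by rewrite addr_ge0 ?sqr_ge0. Qed.

Lemma csq0 : csq 0 = 0.
Proof. by rewrite /csq /= expr0n /= addr0. Qed.

Lemma csqM z w : csq (z * w) = csq z * csq w.
Proof. by case: z => a b; case: w => c d; rewrite /csq /=; ring. Qed.

Lemma csqR (r : R) : csq r%:C%C = r ^+ 2.
Proof. by rewrite /csq /= expr0n addr0. Qed.

Lemma csqDl z w : csq (z + w) <= 2 * csq z + 2 * csq w.
Proof.
case: z => a b; case: w => c d; rewrite /csq /=.
have := sqr_ge0 (a - c); have := sqr_ge0 (b - d); lra.
Qed.

Lemma csqE z : z * z^* = (csq z)%:C%C.
Proof.
case: z => a b; apply/eqP; rewrite eq_complex /csq /=.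
by apply/andP; split; apply/eqP; ring.
Qed.

Lemma csq_eq0 z : csq z = 0 -> z = 0.
Proof.
case: z => a b; rewrite /csq /= => /eqP.
by rewrite paddr_eq0 ?sqr_ge0// !sqrf_eq0 => /andP[/eqP-> /eqP->].
Qed.

Lemma ReD z w : Re (z + w) = Re z + Re w. Proof. by case: z; case: w. Qed.
Lemma ImD z w : Im (z + w) = Im z + Im w. Proof. by case: z; case: w. Qed.

Lemma Re_sum I (r : seq I) (F : I -> C) :
  Re (\sum_(i <- r) F i) = \sum_(i <- r) Re (F i).
Proof. exact: (big_morph _ ReD). Qed.

Lemma Im_sum I (r : seq I) (F : I -> C) :
  Im (\sum_(i <- r) F i) = \sum_(i <- r) Im (F i).
Proof. exact: (big_morph _ ImD). Qed.

(** Stated on the real and the imaginary parts, so that the completeness of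
    the reals applies to complex series. *)
Definition clim s (l : C) :=
  ((fun n => Re (s n)) @ \oo --> Re l) /\ ((fun n => Im (s n)) @ \oo --> Im l).

Lemma clim_unique s l l' : clim s l -> clim s l' -> l = l'.
Proof.
case: l l' => [a b] [c d] [/= ra ib] [/= rc id].
by rewrite (cvg_unique _ ra rc) ?(cvg_unique _ ib id).
Qed.

Lemma clim_lin a s s' l l' : clim s l -> clim s' l' ->
  clim (fun n => a * s n + s' n) (a * l + l').
Proof.
case: a l l' => [a b] [l1 l2] [l1' l2'] [/= r1 i1] [/= r2 i2]; split => /=.
- under eq_fun do rewrite ReD.
  have -> : (fun x => Re ((a +i* b)%C * s x) + Re (s' x)) =
     (fun x => a * Re (s x) - b * Im (s x) + Re (s' x)).
    by apply/funext => n; case: (s n) => ? ?.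
  by apply: cvgD r2; apply: cvgB; apply: cvgMl_tmp.
- under eq_fun do rewrite ImD.
  have -> : (fun x => Im ((a +i* b)%C * s x) + Im (s' x)) =
     (fun x => a * Im (s x) + b * Re (s x) + Im (s' x)).
    by apply/funext => n; case: (s n) => ? ?.
  by apply: cvgD i2; apply: cvgD; apply: cvgMl_tmp.
Qed.

Lemma clim_conj s l : clim s l -> clim (fun n => (s n)^*) l^*.
Proof.
case: l => a b [/= r1 i1]; split => /=.
- by have -> : (fun n => Re (s n)^*) = (fun n => Re (s n))
    by apply/funext => n; case: (s n).
- have -> : (fun n => Im (s n)^*) = (fun n => - Im (s n))
    by apply/funext => n; case: (s n).
  exact: cvgN.
Qed.

Lemma clim_near_cst s l N : (forall n, (N <= n)%N -> s n = l) -> clim s l.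
Proof.
by move=> sl; split; apply: cvg_near_cst; exists N => // n /= Nn; rewrite sl.
Qed.

Definition square_summable : {pred nat -> C} :=
  fun u => `[< exists M, forall n, \sum_(k < n) csq (u k) <= M >].

Lemma square_summable_submod : submod_closed square_summable.
Proof.
split.
  by apply/asboolP; exists 0 => n; rewrite big1// => k _; exact: csq0.
move=> a u v /asboolP[M Mu] /asboolP[N Nv]; apply/asboolP.
exists (2 * (csq a * M) + 2 * N) => n.
apply: (@le_trans _ _ (\sum_(k < n) (2 * (csq a * csq (u k)) + 2 * csq (v k)))).
  apply: ler_sum => k _; apply: le_trans (csqDl _ _) _.
  by rewrite -csqM lerD2l.
rewrite big_split /= -!mulr_sumr.
apply: lerD; last by rewrite ler_wpM2l ?Nv.
by rewrite !ler_wpM2l ?csq_ge0 ?Mu.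
Qed.

(** Both parts of [u k * (v k)^*] are at most [csq (u k) + csq (v k)] in
    absolute value, so the two series converge absolutely. *)
Lemma square_summable_clim u v :
  u \in square_summable -> v \in square_summable ->
  exists l, clim (fun n => \sum_(k < n) u k * (v k)^*) l.
Proof.
move=> /asboolP[M Mu] /asboolP[N Nv].
have dom (f : nat -> R) : (forall k, `|f k| <= csq (u k) + csq (v k)) ->
    cvgn (series f).
  move=> fuv; apply: normed_cvg.
  apply: nondecreasing_is_cvgn.
    by apply: nondecreasing_series => k _ _ /=.
  exists (M + N) => _ [n _ <-]; rewrite /= /series /= big_mkord.
  apply: le_trans (lerD (Mu n) (Nv n)); rewrite -big_split /=.
  exact: ler_sum.
have /cvg_ex[a ra] : cvgn (series (fun k => Re (u k * (v k)^*))).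
  apply: dom => k; case: (u k) (v k) => a b [c d]; rewrite /csq /= ler_norml.
  apply/andP; split; have := sqr_ge0 (a + c); have := sqr_ge0 (a - c);
    have := sqr_ge0 (b - d); have := sqr_ge0 (b + d); nra.
have /cvg_ex[b ib] : cvgn (series (fun k => Im (u k * (v k)^*))).
  apply: dom => k; case: (u k) (v k) => b1 b [c d]; rewrite /csq /= ler_norml.
  apply/andP; split; have := sqr_ge0 (b1 + d); have := sqr_ge0 (b1 - d);
    have := sqr_ge0 (b - c); have := sqr_ge0 (b + c); nra.
exists (a +i* b)%C; split => /=.
- by under eq_fun do
    rewrite Re_sum -(big_mkord xpredT (fun k => Re (u k * (v k)^*))).
- by under eq_fun do
    rewrite Im_sum -(big_mkord xpredT (fun k => Im (u k * (v k)^*))).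
Qed.

End ComplexSequences.

(** * The Hilbert space of square summable sequences *)

Section Ell2.
Context (R : realType).
Local Notation C := R[i].
Local Notation Re := (@complex.Re R).
Local Notation Im := (@complex.Im R).

Record ell2 := Ell2 {
  ell2_val :> nat -> C;
  ell2P : ell2_val \in @square_summable R
}.

HB.instance Definition _ := [isSub for ell2_val].
HB.instance Definition _ := [Choice of ell2 by <:].
HB.instance Definition _ :=
  GRing.isSubmodClosed.Build _ _ (@square_summable R)
    (@square_summable_submod R).
HB.instance Definition _ := [SubChoice_isSubLmodule of ell2 by <:].

Implicit Types u v w : ell2.

(** The sum of the series. The default value 0 is never taken, by
    [ell2_form_clim]. *)
Definition ell2_form u v : C :=
  xget 0 [set l | clim (fun n => \sum_(k < n) u k * (v k)^*) l].

Lemma ell2_form_clim u v :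
  clim (fun n => \sum_(k < n) u k * (v k)^*) (ell2_form u v).
Proof. by apply: xgetPex; apply: square_summable_clim; exact: ell2P. Qed.

Lemma ell2_formE u v l :
  clim (fun n => \sum_(k < n) u k * (v k)^*) l -> ell2_form u v = l.
Proof. exact/clim_unique/ell2_form_clim. Qed.

Lemma ell2_form_finite u v N : (forall k, (N <= k)%N -> u k = 0) ->
  ell2_form u v = \sum_(k < N) u k * (v k)^*.
Proof.
move=> u0; apply: ell2_formE; apply: (@clim_near_cst _ _ _ N) => n Nn.
rewrite -!(big_mkord xpredT (fun k => u k * (v k)^*)) (big_cat_nat (n := N))//=.
rewrite [X in _ + X]big_nat [X in _ + X]big1 ?addr0// => k /andP[Nk _].
by rewrite u0// mul0r.
Qed.

Lemma ell2_form_hermitian u v :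
  ell2_form u v = (-1) ^+ false * (ell2_form v u)^*.
Proof.
rewrite expr0 mul1r; apply: ell2_formE.
have := clim_conj (ell2_form_clim v u).
congr (clim _ _); apply/funext => n; rewrite rmorph_sum; apply: eq_bigr => k _.
by rewrite rmorphM /= conjCK mulrC.
Qed.

Lemma ell2_form_linearl w : linear_for *%R (ell2_form^~ w).
Proof.
move=> a u v; apply: ell2_formE.
have := clim_lin a (ell2_form_clim u w) (ell2_form_clim v w).
congr (clim _ _); apply/funext => n.
rewrite mulr_sumr -big_split; apply: eq_bigr => k _ /=.
by rewrite mulrA -mulrDl.
Qed.

Lemma ell2_form_bilinear : bilinear_for *%R (Num.conj \; *%R) ell2_form.
Proof.
split=> [w|w a u v]; first exact: ell2_form_linearl.
rewrite ell2_form_hermitian (ell2_form_linearl w a u v) /= rmorphD rmorphM.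
by rewrite !expr0 !mul1r (ell2_form_hermitian w u) (ell2_form_hermitian w v)
  !expr0 !mul1r.
Qed.

Lemma ell2_form_csq u :
  (fun n => \sum_(k < n) csq (u k)) @ \oo --> Re (ell2_form u u).
Proof.
have [re_cvg _] := ell2_form_clim u u.
suff -> : (fun n => \sum_(k < n) csq (u k)) =
    (fun n => Re (\sum_(k < n) u k * (u k)^*)) by [].
apply/funext => n; rewrite Re_sum; apply: eq_bigr => k _.
by rewrite csqE.
Qed.

Lemma psum_csq_le u n : \sum_(k < n) csq (u k) <= Re (ell2_form u u).
Proof.
rewrite -(cvg_lim (@Rhausdorff R) (ell2_form_csq (u := u))).
apply: (nondecreasing_cvgn_le (u_ := fun n => \sum_(k < n) csq (u k))).
  move=> p q pq.
  rewrite -!(big_mkord xpredT (fun k => csq (u k))).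
  by apply: nondecreasing_series pq => k _ _; exact: csq_ge0.
by apply/cvg_ex; exists (Re (ell2_form u u)); exact: ell2_form_csq.
Qed.

Lemma ell2_form_le u M :
  (forall n, \sum_(k < n) csq (u k) <= M) -> Re (ell2_form u u) <= M.
Proof.
move=> uM; rewrite -(cvg_lim (@Rhausdorff R) (ell2_form_csq (u := u))).
apply: limr_le.
  by apply/cvg_ex; exists (Re (ell2_form u u)); exact: ell2_form_csq.
by apply: nearW => n; exact: uM.
Qed.

Lemma csq_le_ell2 u k : csq (u k) <= Re (ell2_form u u).
Proof.
apply: le_trans (psum_csq_le u k.+1); rewrite big_ord_recr /= lerDr.
by apply: sumr_ge0 => i _; exact: csq_ge0.
Qed.

Lemma ell2_form_gt0 u : u != 0 -> 0 < ell2_form u u.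
Proof.
move=> u_neq0; rewrite ltcE /=; apply/andP; split.
  have := ell2_form_hermitian u u; rewrite expr0 mul1r.
  case: (ell2_form u u) => a b [] /= /eqP.
  by rewrite -subr_eq0 opprK -mulr2n mulrn_eq0.
have [k uk] : exists k, u k != 0.
  apply: contrapT => /forallNP u0; move: u_neq0 => /eqP; apply.
  apply/val_inj/funext => k; apply: contrapT => /eqP uk.
  exact: (u0 k).
apply: lt_le_trans (csq_le_ell2 u k).
rewrite lt_neqAle csq_ge0 andbT eq_sym.
by apply: contra uk => /eqP/csq_eq0 ->.
Qed.

HB.instance Definition _ :=
  @bilinear_isBilinear.Build _ _ _ _ _ _ ell2_form ell2_form_bilinear.
HB.instance Definition _ :=
  @isHermitianSesquilinear.Build _ _ _ _ ell2_form ell2_form_hermitian.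
HB.instance Definition _ := @isDotProduct.Build _ _ ell2_form ell2_form_gt0.

Definition ell2_space : preHilbert R :=
  @PreHilbert R ell2 (ell2_form : {dot ell2 for Num.conj}).

End Ell2.

(** * Cauchy-Schwarz in pre-Hilbert spaces *)

Section PreHilbertFacts.
Context (R : realType) (V : preHilbert R).
Implicit Types x y z : V.

Lemma inner_ge0 x : 0 <= inner x x.
Proof. exact: dnorm_ge0. Qed.

Lemma innerC x y : inner x y = (inner y x)^*.
Proof. by rewrite /inner hermC expr0 mul1r. Qed.

Lemma innerBl x y z : inner (x - y) z = inner x z - inner y z.
Proof. exact: linearBl. Qed.

Lemma innerBr x y z : inner x (y - z) = inner x y - inner x z.
Proof. exact: linearBr. Qed.

Lemma innerE x : inner x x = (hnorm x ^+ 2)%:C%C.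
Proof.
have := inner_ge0 x; rewrite /hnorm lecE /=; case: (inner x x) => a b /=.
by move=> /andP[/eqP -> a0]; rewrite sqr_sqrtr.
Qed.

Lemma hnorm_ge0 x : 0 <= hnorm x.
Proof. exact: sqrtr_ge0. Qed.

Lemma hnorm_sqr x : hnorm x ^+ 2 = complex.Re (inner x x).
Proof. by rewrite innerE. Qed.

Lemma hnorm0 : hnorm (0 : V) = 0.
Proof. by rewrite /hnorm /inner linear0l sqrtr0. Qed.

Lemma hnormZ_sqr (a : R[i]) x : hnorm (a *: x) ^+ 2 = csq a * hnorm x ^+ 2.
Proof.
rewrite hnorm_sqr /inner linearZl_LR linearZr_LR /= -/(inner x x) innerE mulrA.
by rewrite csqE -rmorphM.
Qed.

Lemma hnorm_lt x (e : R) : 0 < e ->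
  (hnorm x < e) = (complex.Re (inner x x) < e ^+ 2).
Proof.
by move=> e0; rewrite -hnorm_sqr ltr_pXn2r// nnegrE ?hnorm_ge0// ltW.
Qed.

(** The square of the norm of |y|^2 x - <x, y> y is |y|^2 times the
    difference of the two sides. *)
Lemma cauchy_schwarz x y : csq (inner x y) <= hnorm x ^+ 2 * hnorm y ^+ 2.
Proof.
have [->|y0] := eqVneq y 0.
  by rewrite {1}/inner linear0r csq0 mulr_ge0 ?sqr_ge0.
have hy : 0 < hnorm y ^+ 2.
  by have := dnorm_gt0 (ph_inner V) y; rewrite y0 -/(inner y y) innerE ltcR.
have : 0 <= hnorm y ^+ 2 * (hnorm x ^+ 2 * hnorm y ^+ 2 - csq (inner x y)).
  rewrite -lecR.
  have := inner_ge0 ((hnorm y ^+ 2)%:C%C *: x - inner x y *: y).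
  congr (_ <= _).
  rewrite innerBl !innerBr /inner !linearZl_LR !linearZr_LR /=.
  rewrite -!/(inner _ _) (innerC y x) !innerE.
  move: (hnorm x ^+ 2) (hnorm y ^+ 2) => s t.
  have -> : (t%:C%C)^* = t%:C%C :> R[i] by exact: conjc_real.
  by rewrite rmorphM rmorphB rmorphM /= -csqE; ring.
by rewrite pmulr_rge0// subr_ge0.
Qed.

End PreHilbertFacts.

(** * Linear maps on polynomials *)

Section LinearExtension.
Context (K : fieldType) (W : lmodType K).
Implicit Types (phi : nat -> W) (p q : {poly K}).

(** The linear map with prescribed values [phi] on the basis of monomials. *)
Definition lin_ext phi p : W := \sum_(i < size p) p`_i *: phi i.

Lemma lin_ext_widen phi p n : (size p <= n)%N ->
  lin_ext phi p = \sum_(i < n) p`_i *: phi i.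
Proof.
move=> pn; rewrite /lin_ext (big_ord_widen n (fun i => p`_i *: phi i) pn).
rewrite big_mkcond; apply: eq_bigr => i _; case: ltnP => // pi.
by rewrite nth_default// scale0r.
Qed.

Lemma lin_ext_linear phi : linear (lin_ext phi).
Proof.
move=> a p q; pose n := maxn (size p) (size q).
have pn : (size p <= n)%N by exact: leq_maxl.
have qn : (size q <= n)%N by exact: leq_maxr.
rewrite (lin_ext_widen phi pn) (lin_ext_widen phi qn) (@lin_ext_widen phi _ n).
  rewrite scaler_sumr -big_split; apply: eq_bigr => i _ /=.
  by rewrite coefD coefZ scalerDl scalerA.
rewrite (leq_trans (size_polyD _ _))// geq_max qn.
by rewrite (leq_trans (size_scale_leq _ _)).
Qed.

HB.instance Definition _ phi :=
  GRing.isLinear.Build K {poly K} W _ (lin_ext phi) (lin_ext_linear phi).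

Lemma lin_extXn phi n : lin_ext phi 'X^n = phi n.
Proof.
rewrite /lin_ext size_polyXn big_ord_recr /= big1 ?add0r; last first.
  by move=> i _; rewrite coefXn ltn_eqF ?scale0r.
by rewrite coefXn eqxx scale1r.
Qed.

Lemma lin_ext_unique (g : {poly K} -> W) p :
  linear g -> g p = lin_ext (fun n => g 'X^n) p.
Proof.
move=> g_lin; pose G := GRing.isLinear.Build K {poly K} W _ g g_lin.
pose g' : {linear {poly K} -> W} := HB.pack g G.
rewrite -[in LHS](coefK p) poly_def -[LHS]/(g' _) linear_sum.
by apply: eq_bigr => i _; rewrite linearZ.
Qed.

Lemma lin_ext_linear_seq (a : K) phi psi p :
  lin_ext (fun n => a *: phi n + psi n) p = a *: lin_ext phi p + lin_ext psi p.
Proof.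
rewrite scaler_sumr -big_split; apply: eq_bigr => i _.
by rewrite scalerDr !scalerA mulrC.
Qed.

End LinearExtension.

Lemma eq_lin_ext (K : fieldType) (W : lmodType K) (phi psi : nat -> W) :
  phi =1 psi -> lin_ext phi =1 lin_ext psi.
Proof. by move=> e p; apply: eq_bigr => i _; rewrite e. Qed.

Lemma lin_ext_comp (K : fieldType) (W V : lmodType K) (g : {linear W -> V}) phi
    (p : {poly K}) :
  g (lin_ext phi p) = lin_ext (fun n => g (phi n)) p.
Proof. by rewrite linear_sum; apply: eq_bigr => i _; rewrite linearZ. Qed.

Lemma coef_lin_ext (K : fieldType) (phi : nat -> {poly K}) (p : {poly K}) k :
  (lin_ext phi p)`_k = \sum_(i < size p) p`_i * (phi i)`_k.
Proof. by rewrite coef_sum; apply: eq_bigr => i _; rewrite coefZ. Qed.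

Lemma sum_coef_delta (K : fieldType) (p : {poly K}) j (w : K) :
  \sum_(i < size p) p`_i * ((i == j :> nat)%:R * w) = p`_j * w.
Proof.
have [jp|pj] := ltnP j (size p).
  rewrite (bigD1 (Ordinal jp))//= eqxx mul1r big1 ?addr0// => i.
  by rewrite -val_eqE /= => /negPf ->; rewrite mul0r mulr0.
rewrite nth_default// mul0r big1// => i _.
by rewrite ltn_eqF ?mul0r ?mulr0// (leq_trans _ pj).
Qed.

Lemma inner_lin_ext (R : realType) (V : preHilbert R) (phi : nat -> V)
    (p : {poly R[i]}) z :
  inner (lin_ext phi p) z = \sum_(i < size p) p`_i * inner (phi i) z.
Proof.
rewrite /inner /lin_ext linear_sumlz; apply: eq_bigr => i _.
by rewrite linearZl_LR.
Qed.

(** * Polynomials and their completion *)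

Section PolynomialSpace.
Context (R : realType).
Local Notation C := R[i].
Local Notation Re := (@complex.Re R).
Local Notation Im := (@complex.Im R).
Implicit Types p q : {poly C}.

Lemma coef_square_summable p : (fun k => p`_k) \in @square_summable R.
Proof.
apply/asboolP; exists (\sum_(k < size p) csq p`_k) => n.
rewrite -!(big_mkord xpredT (fun k => csq p`_k)).
have pm : (size p <= maxn n (size p))%N := leq_maxr _ _.
rewrite [leRHS](_ : _ = \sum_(0 <= k < maxn n (size p)) csq p`_k).
  rewrite (big_cat_nat (n := n) _ (leq_maxl _ _))//= lerDl.
  by apply: sumr_ge0 => k _; exact: csq_ge0.
rewrite (big_cat_nat (n := size p) _ pm)//=.
rewrite [X in _ + X]big_nat [X in _ + X]big1 ?addr0//.
by move=> k /andP[pk _]; rewrite nth_default ?csq0.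
Qed.

Definition coef_ell2 p : ell2_space R := Ell2 (coef_square_summable p).

Lemma coef_ell2_linear : linear coef_ell2.
Proof.
by move=> a p q; apply/val_inj/funext => k; rewrite /= coefD coefZ.
Qed.

HB.instance Definition _ :=
  GRing.isLinear.Build C {poly C} (ell2_space R) _ coef_ell2 coef_ell2_linear.

Lemma coef_ell2_inj : injective coef_ell2.
Proof. by move=> p q [pq]; apply/polyP => k; rewrite (congr1 (@^~ k) pq). Qed.

Definition poly_form p q : C := inner (coef_ell2 p) (coef_ell2 q).

Lemma poly_form_bilinear : bilinear_for *%R (Num.conj \; *%R) poly_form.
Proof.
by split=> [q a p p'|p a q q'];
  rewrite /poly_form /inner linearP ?linearPl ?linearPr.
Qed.

Lemma poly_form_hermitian p q :
  poly_form p q = (-1) ^+ false * (poly_form q p)^*.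
Proof. by rewrite /poly_form innerC expr0 mul1r. Qed.

Lemma poly_form_gt0 p : p != 0 -> 0 < poly_form p p.
Proof.
move=> p0; apply: ell2_form_gt0.
by rewrite -(linear0 coef_ell2) (inj_eq coef_ell2_inj).
Qed.

HB.instance Definition _ :=
  @bilinear_isBilinear.Build _ _ _ _ _ _ poly_form poly_form_bilinear.
HB.instance Definition _ :=
  @isHermitianSesquilinear.Build _ _ _ _ poly_form poly_form_hermitian.
HB.instance Definition _ := @isDotProduct.Build _ _ poly_form poly_form_gt0.

Definition poly_space : preHilbert R :=
  @PreHilbert R {poly C} (poly_form : {dot {poly C} for Num.conj}).

Lemma inner_coef_ell2 (p : {poly C}) (u : ell2_space R) N : (size p <= N)%N ->
  inner (coef_ell2 p) u = \sum_(k < N) p`_k * (u k)^*.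
Proof.
move=> pN; apply: ell2_form_finite => k Nk /=.
by rewrite nth_default// (leq_trans pN Nk).
Qed.

Lemma poly_inner_Xnl n (p : poly_space) :
  inner ('X^n : poly_space) p = ((p : {poly C})`_n)^*.
Proof.
rewrite [LHS](inner_coef_ell2 _ (N := n.+1)) ?size_polyXn//=.
rewrite big_ord_recr /= big1.
  by rewrite add0r !coefXn eqxx mul1r.
by move=> i _; rewrite coefXn ltn_eqF ?mul0r.
Qed.

Lemma hnorm_ell2_le (u : ell2_space R) (e : R) : 0 <= e ->
  (forall n, \sum_(k < n) csq (u k) <= e ^+ 2) -> hnorm u <= e.
Proof.
move=> e0 ue; rewrite -(ler_pXn2r (n := 2)) ?nnegrE ?hnorm_ge0//.
by rewrite hnorm_sqr; exact: ell2_form_le.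
Qed.

Lemma psum_csq_hnorm (u : ell2_space R) n :
  \sum_(k < n) csq (u k) <= hnorm u ^+ 2.
Proof. by rewrite hnorm_sqr; exact: psum_csq_le. Qed.

(** The polynomial is the truncation of [z] at a large order; as it is
    orthogonal to the remainder, the squared norm of the remainder is a tail
    of the series of the [csq (z k)]. *)
Lemma poly_dense (z : ell2_space R) (e : R) : 0 < e ->
  exists p : poly_space, hnorm (z - coef_ell2 p) < e.
Proof.
move=> e0; have e2 : 0 < e ^+ 2 by rewrite exprn_gt0.
have /cvgrPdist_lt /(_ _ e2)[N _ Nz] := ell2_form_csq (u := z).
pose p : {poly C} := \poly_(k < N) z k.
have pN : (size p <= N)%N by exact: size_poly.
have pk (k : 'I_N) : p`_k = z k by rewrite coef_poly ltn_ord.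
exists p; rewrite hnorm_lt//.
have orth : inner (z - coef_ell2 p) (coef_ell2 p) = 0.
  rewrite innerC (inner_coef_ell2 _ pN) big1 ?conjC0// => k _.
  by rewrite -[(z - _) k]/(z k - p`_k) pk subrr conjC0 mulr0.
have -> : inner (z - coef_ell2 p) (z - coef_ell2 p) =
    inner z z - (\sum_(k < N) csq (z k))%:C%C.
  rewrite innerBr orth subr0 innerBl (inner_coef_ell2 _ pN).
  congr (_ - _); rewrite rmorph_sum; apply: eq_bigr => k _.
  by rewrite pk csqE.
have := Nz N (leqnn _); rewrite ger0_norm ?subr_ge0 ?psum_csq_le//.
by rewrite -[ell2_form z z]/(inner z z); case: (inner z z).
Qed.

(** A Cauchy sequence converges coordinatewise, and each bound on a partial
    sum of [csq (u n k - u m k)] over k passes to the limit in m. *)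
Lemma ell2_complete (u : nat -> ell2_space R) :
  (forall e : R, 0 < e -> exists N : nat, forall m n : nat,
     (N <= m)%N -> (N <= n)%N -> hnorm (u m - u n) < e) ->
  exists l : ell2_space R, forall e : R, 0 < e -> exists N : nat,
    forall n : nat, (N <= n)%N -> hnorm (u n - l) < e.
Proof.
move=> cu.
have coord k : exists l : C, clim (fun n => u n k) l.
  (* [f] is the real or the imaginary part; both are Lipschitz for the norm
     of the sequence space. *)
  have real_cauchy (f : C -> R) :
      (forall x y, f (x - y) = f x - f y) -> (forall x, f x ^+ 2 <= csq x) ->
      cvgn (fun n => f (u n k)).
    move=> fB fle; apply/cauchy_cvgP/cauchyP => e e0.
    have [N Nu] := cu _ e0; exists (f (u N k)).
    exists N => // n /= Nn; rewrite -ball_normE /= -fB.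
    apply: le_lt_trans (Nu _ _ (leqnn N) Nn).
    rewrite -(ler_pXn2r (n := 2)) ?nnegrE ?hnorm_ge0// real_normK ?num_real//.
    apply: le_trans (fle _) _; rewrite hnorm_sqr.
    exact: (csq_le_ell2 (u N - u n) k).
  have /cvg_ex[a ra] : cvgn (fun n => Re (u n k)).
    apply: real_cauchy => [x y|x]; last by rewrite /csq lerDl sqr_ge0.
    by case: x y => ? ? [].
  have /cvg_ex[b ib] : cvgn (fun n => Im (u n k)).
    apply: real_cauchy => [x y|x]; last by rewrite /csq lerDr sqr_ge0.
    by case: x y => ? ? [].
  by exists (a +i* b)%C.
have [l ul] := choice coord.
have csq_cvg n k : (fun m => csq (u n k - u m k)) @ \oo --> csq (u n k - l k).
  have [re_l im_l] := ul k.
  have -> : (fun m => csq (u n k - u m k)) = (fun m =>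
      (Re (u n k) - Re (u m k)) * (Re (u n k) - Re (u m k)) +
      (Im (u n k) - Im (u m k)) * (Im (u n k) - Im (u m k))).
    apply/funext => m; rewrite /csq !expr2.
    by case: (u n k) (u m k) => ? ? [].
  have -> : csq (u n k - l k) =
      (Re (u n k) - Re (l k)) * (Re (u n k) - Re (l k)) +
      (Im (u n k) - Im (l k)) * (Im (u n k) - Im (l k)).
    by rewrite /csq !expr2; case: (u n k) (l k) => ? ? [].
  by apply: cvgD; apply: cvgM; apply: cvgB => //; exact: cvg_cst.
have tail e : 0 < e -> exists N, forall n, (N <= n)%N -> forall m,
    \sum_(k < m) csq (u n k - l k) <= e ^+ 2.
  move=> e0; have [N Nu] := cu _ e0; exists N => n Nn m.
  have sum_cvg : (fun j => \sum_(k < m) csq (u n k - u j k)) @ \oo -->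
      \sum_(k < m) csq (u n k - l k).
    elim: m => [|m IH].
      under eq_fun do rewrite big_ord0; rewrite big_ord0.
      exact: cvg_cst.
    under eq_fun do rewrite big_ord_recr; rewrite big_ord_recr.
    by apply: cvgD.
  rewrite -(cvg_lim (@Rhausdorff R) sum_cvg).
  apply: limr_le; first by apply/cvg_ex; eexists; exact: sum_cvg.
  exists N => // j /= Nj; apply: le_trans (psum_csq_hnorm (u n - u j) m) _.
  by rewrite ler_pXn2r ?nnegrE ?hnorm_ge0 ?ltW// Nu.
have l_in : l \in @square_summable R.
  have [N Nl] := tail 1 ltr01.
  have d_in : (fun k => u N k - l k) \in @square_summable R.
    by apply/asboolP; exists (1 ^+ 2); exact: Nl.
  (* The limit differs from a term of the sequence by a square summable
     sequence. *)
  have -> : l = (-1) *: (fun k => u N k - l k) + u N :> (nat -> C).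
    apply/funext => k.
    by rewrite -[RHS]/(-1 * (u N k - l k) + u N k) mulN1r opprB subrK.
  have [_] := @square_summable_submod R; apply=> //; exact: ell2P.
exists (Ell2 l_in) => e e0.
have e2 : 0 < e / 2 by rewrite divr_gt0.
have [N Nl] := tail _ e2; exists N => n Nn.
apply: le_lt_trans (_ : e / 2 < e); last by lra.
by apply: hnorm_ell2_le => [|m]; [exact: ltW|exact: Nl].
Qed.

Definition poly_completion : completion poly_space :=
  @Completion R poly_space (ell2_space R) coef_ell2 (fun _ _ => erefl)
    poly_dense ell2_complete.

End PolynomialSpace.

(** * The full Fock space over the polynomials *)

Section FullFock.
Context (R : realType).
Local Notation C := R[i].
Local Notation P := (poly_space R).
Implicit Types (x y p q : {poly C}) (s t : seq P).

(** With [CodeSeq.code], a number stands for a word, and [cons_code i n]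
    stands for the word coded by [n] with the letter [i] put in front. *)
Definition cons_code i n := CodeSeq.code (i :: CodeSeq.decode n).

Lemma cons_code_eq i n j m :
  (cons_code i n == cons_code j m) = (i == j) && (n == m).
Proof.
rewrite (can_eq CodeSeq.codeK) eqseq_cons; congr (_ && _).
exact: (can_eq CodeSeq.decodeK).
Qed.

Lemma cons_code_gt0 i n : (0 < cons_code i n)%N.
Proof. by rewrite muln_gt0 expn_gt0. Qed.

(** The product of a vector with a tensor: it sends the monomials of
    exponents [i] and [n] to the one whose exponent codes the extended word.
    As [cons_code] is injective, monomials become pairwise orthogonal
    products. *)
Definition tens_cons x q : {poly C} :=
  lin_ext (fun i => lin_ext (fun n => 'X^(cons_code i n)) q) x.

Definition poly_tens s : P := foldr tens_cons 1 s.

Lemma tens_cons_linear x : linear (tens_cons x).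
Proof.
move=> a p q; rewrite /tens_cons -lin_ext_linear_seq; apply: eq_lin_ext => i.
exact: linearP.
Qed.

Lemma poly_tens_multilinear : multilinear poly_tens.
Proof.
move=> s t a x y; elim: s => [|z s IH] /=; first exact: linearP.
by rewrite IH; exact: tens_cons_linear.
Qed.

Lemma poly_tens_Xn (w : seq nat) :
  poly_tens [seq 'X^k | k <- w] = 'X^(CodeSeq.code w) :> {poly C}.
Proof.
elim: w => [|k w IH]; first by rewrite expr0.
rewrite -[LHS]/(tens_cons _ (poly_tens [seq 'X^k | k <- w])) IH /tens_cons.
by rewrite !lin_extXn /cons_code CodeSeq.codeK.
Qed.

Lemma tens_cons_coef x q i n : (tens_cons x q)`_(cons_code i n) = x`_i * q`_n.
Proof.
rewrite coef_lin_ext -sum_coef_delta; apply: eq_bigr => j _; congr (_ * _).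
rewrite coef_lin_ext -[RHS]mulr1 -mulrA mulrCA -sum_coef_delta.
apply: eq_bigr => m _; congr (_ * _).
by rewrite coefXn cons_code_eq mulr1 -natrM mulnb andbC eq_sym [i == j]eq_sym.
Qed.

Lemma poly_inner_tens_cons x y p q :
  inner (tens_cons x p : P) (tens_cons y q : P) =
  inner (x : P) (y : P) * inner (p : P) (q : P).
Proof.
rewrite inner_lin_ext [inner (x : P) _](inner_coef_ell2 _ (leqnn _)) mulr_suml.
apply: eq_bigr => i _; rewrite inner_lin_ext -mulrA; congr (_ * _).
rewrite [inner (p : P) _](inner_coef_ell2 _ (leqnn _)) mulr_sumr.
apply: eq_bigr => n _; rewrite poly_inner_Xnl tens_cons_coef rmorphM.
by rewrite mulrCA.
Qed.

(** Tensors of different lengths are orthogonal because only the empty word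
    has code 0. *)
Lemma poly_inner_tens s t : inner (poly_tens s) (poly_tens t) =
  if size s == size t then \prod_(p <- zip s t) inner p.1 p.2 else 0.
Proof.
have inner_cons x q : inner ((1 : {poly C}) : P) (tens_cons x q : P) = 0.
  rewrite -(expr0 'X) poly_inner_Xnl coef_lin_ext big1 ?conjC0// => i _.
  rewrite coef_lin_ext big1 ?mulr0// => n _.
  by rewrite coefXn ltn_eqF ?cons_code_gt0 ?mulr0.
elim: s t => [|x s IH] [|y t] /=.
- by rewrite big_nil -(expr0 'X) poly_inner_Xnl coefXn eqxx conjC1.
- exact: inner_cons.
- by rewrite innerC inner_cons conjC0.
- rewrite poly_inner_tens_cons IH eqSS; case: ifP => _; last by rewrite mulr0.
  by rewrite big_cons.
Qed.

Section Universal.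
Context (W : lmodType C) (f : seq P -> W).
Hypothesis f_multi : multilinear f.

(** The values of [f] on the words in the basis vectors, which determine it. *)
Definition word_ext : nat -> W :=
  fun n => f [seq ('X^k : {poly C}) | k <- CodeSeq.decode n].

(** The prefix [u] lets the induction go through: the first letter of the
    tensor is expanded in the basis and joins the prefix. *)
Lemma lin_ext_tens s u :
  lin_ext (fun n => f (u ++ [seq ('X^k : {poly C}) | k <- CodeSeq.decode n]))
    (poly_tens s) = f (u ++ s).
Proof.
elim: s u => [|x s IH] u; first exact: (lin_extXn _ 0).
rewrite -[poly_tens _]/(tens_cons x (poly_tens s)) /tens_cons lin_ext_comp.
have f_lin : linear (fun z => f (u ++ z :: s)) by move=> a y z; exact: f_multi.
rewrite (lin_ext_unique x f_lin); apply: eq_lin_ext => i; rewrite lin_ext_comp.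
rewrite -cat_rcons -IH; apply: eq_lin_ext => n.
by rewrite /= lin_extXn /cons_code CodeSeq.codeK cat_rcons.
Qed.

Lemma poly_tens_universal :
  exists2 g : {linear P -> W}, (forall s, g (poly_tens s) = f s) &
    forall g' : {linear P -> W}, (forall s, g' (poly_tens s) = f s) -> g' =1 g.
Proof.
exists (lin_ext word_ext : {linear {poly C} -> W}) => [s|g' g'f p].
  exact: (lin_ext_tens s [::]).
rewrite (lin_ext_unique p (g := g')); last by move=> a x y; exact: linearP.
apply: eq_lin_ext => n; rewrite /word_ext -g'f poly_tens_Xn CodeSeq.decodeK.
by [].
Qed.

End Universal.

Definition poly_fock : full_fock P :=
  @FullFock R P P poly_tens poly_tens_multilinear poly_tens_universal
    poly_inner_tens.

End FullFock.

(** * Adjoints of Hilbert-Schmidt maps *)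

Section Adjoint.
Context (R : realType) (V : preHilbert R) (v : nat -> V) (M : R).
Hypothesis v_summable : forall n, \sum_(k < n) hnorm (v k) ^+ 2 <= M.

Lemma adjoint_square_summable y :
  (fun k => inner y (v k)) \in @square_summable R.
Proof.
apply/asboolP; exists (hnorm y ^+ 2 * M) => n.
apply: le_trans (ler_wpM2l (sqr_ge0 _) (v_summable n)).
by rewrite mulr_sumr; apply: ler_sum => k _; exact: cauchy_schwarz.
Qed.

Definition adjoint y : ell2_space R := Ell2 (adjoint_square_summable y).

Lemma adjoint_linear : linear adjoint.
Proof.
by move=> a x y; apply/val_inj/funext => k; rewrite /= /inner linearPl.
Qed.

HB.instance Definition _ :=
  GRing.isLinear.Build R[i] V (ell2_space R) _ adjoint adjoint_linear.

(** If the vectors [v n] are square summable in norm, the Hilbert-Schmidt map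
    that sends the n-th basis vector to [v n] has an adjoint defined
    everywhere. *)
Lemma adjointP (p : poly_space R) y :
  inner (lin_ext v p) y = inner (coef_ell2 p) (adjoint y).
Proof.
rewrite inner_lin_ext (inner_coef_ell2 _ (leqnn _)).
by apply: eq_bigr => i _; rewrite [inner (v i) y]innerC.
Qed.

End Adjoint.

(** * Weights *)

(** Take c_n = 1 / t_n, where t_n is at least 1, at least [h n] and at least
    every [g m n] and [g n m] with m at most n; then [g m n] is at most t_m
    t_n whichever index is larger. *)
Lemma exists_weights (R : realFieldType) (h : nat -> R) (g : nat -> nat -> R) :
  exists c : nat -> R, [/\ forall n, 0 < c n, forall n, c n ^+ 2 * h n <= 1 &
    forall m n, (c m * c n) ^+ 2 * g m n <= 1].
Proof.
pose t n := 1 + `|h n| + \sum_(m < n.+1) (`|g m n| + `|g n m|).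
have sum_ge0 n : 0 <= \sum_(m < n.+1) (`|g m n| + `|g n m|).
  by apply: sumr_ge0 => m _; rewrite addr_ge0.
have t_ge1 n : 1 <= t n by rewrite /t -addrA lerDl addr_ge0.
have t_gt0 n : 0 < t n by apply: lt_le_trans (t_ge1 n).
have h_t n : h n <= t n.
  apply: le_trans (ler_norm _) _; rewrite /t -addrA addrCA lerDl.
  by rewrite addr_ge0.
have g_t m n : (m <= n)%N -> g m n <= t n /\ g n m <= t n.
  move=> mn; have mn1 : (m < n.+1)%N by [].
  have: `|g m n| + `|g n m| <= t n.
    rewrite /t (bigD1 (Ordinal mn1))//= addrCA lerDl !addr_ge0//.
    by apply: sumr_ge0 => i _; rewrite addr_ge0.
  have := ler_norm (g m n); have := ler_norm (g n m).
  by have := normr_ge0 (g m n); have := normr_ge0 (g n m); split; lra.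
have t_sqr (x a : R) : 1 <= x -> a <= x -> x^-1 ^+ 2 * a <= 1.
  move=> x1 ax; have x0 : 0 < x by apply: lt_le_trans x1.
  by rewrite exprVn ler_pdivrMl ?exprn_gt0// mulr1; nra.
exists (fun n => (t n)^-1); split=> [n|n|m n]; first by rewrite invr_gt0.
  exact: t_sqr.
rewrite -invfM; apply: t_sqr; first by have := t_ge1 m; have := t_ge1 n; nra.
have := t_ge1 m; have := t_ge1 n.
by have [mn|/ltnW nm] := leqP m n;
  [have [+ _] := g_t _ _ mn|have [_ +] := g_t _ _ nm]; nra.
Qed.

Lemma sum_geometric_le2 (R : realFieldType) n : \sum_(k < n) (2 ^- k : R) <= 2.
Proof.
have -> : \sum_(k < n) (2 ^- k : R) = 2 - 2 * 2 ^- n.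
  elim: n => [|n IH]; first by rewrite big_ord0 expr0 invr1 mulr1 subrr.
  have e : 2 * 2 ^- n.+1 = 2 ^- n :> R by rewrite exprS invfM mulVKf ?pnatr_eq0.
  by rewrite big_ord_recr /= IH e; move: (2 ^- n) => z; lra.
by rewrite gerBl mulr_ge0// invr_ge0 exprn_ge0.
Qed.

(** * Regularity *)

Section Regular.
Context (R : realType) (I2 : fock2 R).
Local Notation H := (f2_H1 I2).
Local Notation Phi := (f2_Phi I2).
Local Notation P := (poly_space R).

Lemma countable_spanning_sequence : has_countable_hamel_basis H ->
  exists f : nat -> H, span (range f) = setT.
Proof.
move=> [B [/countable_injP[i i_inj] [_ spanB]]].
(* A finite basis is padded with zeros, so that one index set serves all
   cases. *)
pose f n := xget 0 [set x | B x /\ i x = n].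
exists f; apply/seteqP; split=> // x _.
have : span B x by rewrite spanB.
move=> [s [c [sB ->]]]; exists s, c; split=> // y ys; exists (i y) => //.
have [_ iy] : [set x | B x /\ i x = i y] (f (i y)).
  by apply: xgetPex; exists y; split=> //; exact: sB.
apply: i_inj => //; rewrite inE; last exact: sB.
by have [] : [set x | B x /\ i x = i y] (f (i y));
  first by apply: xgetPex; exists y; split=> //; exact: sB.
Qed.

Section Construction.
Variable f : nat -> H.
Hypothesis f_span : span (range f) = setT.
Variable c : nat -> R.
Hypothesis c_gt0 : forall n, 0 < c n.
Hypothesis c_f : forall n,
  c n ^+ 2 * (2 ^+ CodeSeq.code [:: n] * hnorm (f n) ^+ 2) <= 1.
Hypothesis c_Phi : forall m n,
  (c m * c n) ^+ 2 * (2 ^+ CodeSeq.code [:: m; n] * csq (Phi (f m) (f n))) <= 1.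

Definition weighted_sum : {linear {poly R[i]} -> H} :=
  lin_ext (fun n => (c n)%:C%C *: f n).

(** The weights do not vanish, so the rescaled sequence still spans. *)
Lemma weighted_sum_surj x : exists p, weighted_sum p = x.
Proof.
have : span (range f) x by rewrite f_span.
move=> [s [a [sf ->]]]; elim: s sf => [|y s IH] sf.
  by exists 0; rewrite big_nil linear0.
have [p ps] : exists p, weighted_sum p = \sum_(y <- s) a y *: y.
  by apply: IH => z zs; apply: sf; rewrite inE zs orbT.
have [n _ fn] := sf y (mem_head _ _).
exists ((a y / (c n)%:C%C) *: 'X^n + p).
rewrite big_cons -ps linearP /= lin_extXn scalerA divfK ?fn//.
by rewrite eq_complex /= negb_and gt_eqF.
Qed.

Definition weighted_basing : {linear P -> (fock2_if I2 -> fock2_if I2)} :=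
  iso_basing I2 \o weighted_sum.

Lemma weighted_basingP : basing weighted_basing.
Proof.
apply/seteqP; split=> [_ [p _ <-]|_ [x _ <-]].
  by exists (weighted_sum p).
by have [p <-] := weighted_sum_surj x; exists p.
Qed.

Definition word_vector (s : seq P) : fock2_if I2 :=
  foldr (fun x v => weighted_basing x v) (if_vac (fock2_if I2)) s.

Lemma word_vector_multilinear : multilinear word_vector.
Proof.
move=> s t a x y; elim: s => [|z s IH] /=.
  by rewrite -[LHS]/(weighted_basing (a *: x + y) (word_vector t)) linearP.
rewrite -[LHS]/(weighted_basing z (word_vector _)) IH.
exact: f2_create_linearr.
Qed.

Lemma f2_hnorm_sqr (v : f2_space H) :
  hnorm v ^+ 2 = csq v.1.1 + hnorm v.1.2 ^+ 2 + csq v.2.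
Proof.
rewrite [LHS]hnorm_sqr f2_inner innerE !csqE -!rmorphD.
by [].
Qed.

(** Words of length 0 have code 0 and are sent to the unit vacuum, the
    hypotheses on the weights treat the words of length 1 and 2, and longer
    words are sent to 0. *)
Lemma word_vector_hnorm n :
  hnorm (word_ext word_vector n) ^+ 2 <= 2 ^- n.
Proof.
rewrite /word_ext -[in leRHS](CodeSeq.decodeK n).
have pow2 k (r : R) : 2 ^+ k * r <= 1 -> r <= 2 ^- k.
  by move=> ?; rewrite -[leRHS]mulr1 ler_pdivlMl ?exprn_gt0.
case: (CodeSeq.decode n) => [|k [|m [|j w]]] /=; apply: pow2.
- rewrite expr0 mul1r hnorm_sqr; have := if_vac_unit (fock2_if I2).
  by move=> ->.
- apply: le_trans (c_f k); rewrite [leRHS]mulrCA ler_pM2l ?exprn_gt0//.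
  rewrite f2_hnorm_sqr /= linear0r lin_extXn scale1r csq0 add0r addr0.
  by rewrite hnormZ_sqr csqR.
- apply: le_trans (c_Phi k m); rewrite [leRHS]mulrCA ler_pM2l ?exprn_gt0//.
  rewrite f2_hnorm_sqr /= !lin_extXn scale1r scale0r hnorm0 csq0.
  rewrite expr0n /= !add0r linearZl_LR linearZr_LR /= mulrA csqM -rmorphM.
  by rewrite csqR.
- rewrite f2_hnorm_sqr /= !scale0r linear0r hnorm0 csq0.
  by rewrite expr0n /= !addr0 mulr0.
Qed.

Lemma weighted_basing_regular : regular_basing weighted_basing.
Proof.
split; first exact: weighted_basingP.
have sum_le n : \sum_(k < n) hnorm (word_ext word_vector k) ^+ 2 <= 2.
  apply: le_trans (sum_geometric_le2 R n).
  by apply: ler_sum => k _; exact: word_vector_hnorm.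
exists (poly_fock R), (poly_completion R).
exists (lin_ext (word_ext word_vector) : {linear {poly R[i]} -> fock2_if I2}).
exists (adjoint sum_le); split=> [s|p y]; last exact: adjointP.
exact: (lin_ext_tens word_vector_multilinear s [::]).
Qed.

End Construction.

Theorem countable_basis_regular :
  has_countable_hamel_basis H -> regular (fock2_if I2).
Proof.
move=> /countable_spanning_sequence[f f_span].
have [c [c_gt0 c_f c_Phi]] := exists_weights
  (fun n => 2 ^+ CodeSeq.code [:: n] * hnorm (f n) ^+ 2)
  (fun m n => 2 ^+ CodeSeq.code [:: m; n] * csq (Phi (f m) (f n))).
exists P, (weighted_basing f c); exact: weighted_basing_regular.
Qed.

End Regular.

(** * Failure of iso-regularity *)

Section NotIsoRegular.
Context (R : realType).
Local Notation C := R[i].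
Local Notation P := (poly_space R).

(** An unbounded bilinear form: it is n on the unit vectors X^n and 1. *)
Definition deriv_form (p q : P) : C := (p^`() * q).[1].

Lemma deriv_form_bilinear : bilinear_for *%R *%R deriv_form.
Proof.
split=> [q a p p'|p a q q']; rewrite /deriv_form.
  by rewrite linearP /= mulrDl hornerD -scalerAl hornerZ.
by rewrite mulrDr hornerD -scalerAr hornerZ.
Qed.

HB.instance Definition _ :=
  @bilinear_isBilinear.Build _ _ _ _ _ _ deriv_form deriv_form_bilinear.

Lemma deriv_form_Xn n : deriv_form 'X^n 1 = n%:R.
Proof. by rewrite /deriv_form mulr1 derivXn hornerMn hornerXn expr1n. Qed.

Lemma deriv_form_neq0 : exists p q, deriv_form p q != 0.
Proof. by exists 'X^1, 1; rewrite deriv_form_Xn oner_eq0. Qed.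

Definition deriv_fock2 : fock2 R :=
  @Fock2 R P (deriv_form : {biscalar P}) deriv_form_neq0.

Lemma monomials_hamel_basis : hamel_basis (range (fun n => 'X^n : P)).
Proof.
split.
  move=> s c s_uniq sX sum0 x xs; have [n _ xn] := sX x xs.
  have coefP (y : {poly C}) m : 'X^m = y -> y`_n = (n == m)%:R.
    by move=> <-; rewrite coefXn.
  have : (\sum_(y <- s) c y *: (y : {poly C}))`_n = 0 by rewrite sum0 coef0.
  rewrite coef_sum (bigD1_seq x)//= coefZ (coefP x n)// eqxx mulr1.
  rewrite big_seq_cond big1 ?addr0// => y /andP[ys yx].
  have [m _ ym] := sX y ys; rewrite coefZ (coefP y m)//.
  have [nm|] := eqVneq n m; last by rewrite mulr0.
  by move: yx; rewrite -xn -ym nm eqxx.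
apply/seteqP; split=> // p _.
exists [seq 'X^n | n <- iota 0 (size (p : {poly C}))].
exists (fun q : P => p`_(size (q : {poly C})).-1).
split=> [x /mapP[n _ ->]|]; first by exists n.
rewrite big_map -[X in iota 0 X]subn0 big_mkord -[LHS]coefK poly_def.
by apply: eq_bigr => n _; rewrite size_polyXn.
Qed.

(** By Cauchy-Schwarz, applied to the tensor of X^n and 1, which is a unit
    vector, an adjoint would give n^2 <= |adjoint of Omega_2|^2 for all n. *)
Lemma deriv_fock2_not_iso_regular : ~ iso_regular deriv_fock2.
Proof.
move=> [_ [F [K [L [Ladj [LE adjE]]]]]].
pose Y : fock2_if deriv_fock2 := (0, 0, 1).
have bound n : n%:R <= hnorm (Ladj Y) ^+ 2.
  pose X := ff_tens F [:: ('X^n : P); (1 : {poly C})].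
  have hX : hnorm (cp_emb K X) ^+ 2 = 1.
    rewrite hnorm_sqr cp_isometric ff_inner /= !big_cons big_nil mulr1.
    rewrite poly_inner_Xnl coefXn eqxx conjC1 mul1r.
    by rewrite -{1}(expr0 'X) poly_inner_Xnl coef1 eqxx conjC1.
  have LX : inner (L X) Y = n%:R.
    rewrite (LE _) f2_inner /= scale1r deriv_form_Xn.
    by rewrite /inner linear0r mul0r !add0r conjC1 mulr1.
  have := cauchy_schwarz (cp_emb K X) (Ladj Y).
  rewrite -adjE LX hX mul1r -(rmorph_nat (real_complex R)) csqR.
  apply: le_trans; rewrite -natrX ler_nat.
  by case: n {X hX LX} => // n; rewrite expnS expn1 leq_pmulr.
have := archi_boundP (sqr_ge0 (hnorm (Ladj Y))).
by rewrite ltNge bound.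
Qed.

Theorem countable_basis_not_iso_regular : exists I2 : fock2 R,
  has_countable_hamel_basis (f2_H1 I2) /\ ~ iso_regular I2.
Proof.
exists deriv_fock2; split; last exact: deriv_fock2_not_iso_regular.
exists (range (fun n => 'X^n : P)); split; last exact: monomials_hamel_basis.
exact: card_image_le.
Qed.

End NotIsoRegular.

Theorem corollary8p15 (R : realType) :
  (forall I2 : fock2 R,
     has_countable_hamel_basis (f2_H1 I2) -> regular (fock2_if I2)) /\
  (exists I2 : fock2 R,
     has_countable_hamel_basis (f2_H1 I2) /\ ~ iso_regular I2).
Proof.
split; first exact: countable_basis_regular.
exact: countable_basis_not_iso_regular.
Qed.
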